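(* Let $(H,R)$ be a (finite dimensional) semisimple factorizable Hopf algebra over an algebraically closed field $k$, with transmuted braided group $H_R$. Then every subcoalgebra of $H_R$ is $H$-stable, i.e. every subspace $C\subseteq H$ with $\Delta_R(C)\subseteq C\otimes C$ satisfies $h\cdot_{ad}c\in C$ for all $h\in H$, $c\in C$.
   Context: Notation: $\Delta(h)=h_{(1)}\otimes h_{(2)}$ is the coproduct and $S$ the antipode of $H$; $R=R^1\otimes R^2$ (summation understood) is the universal $R$-matrix, and $R_1=R_1{}^1\otimes R_1{}^2$, $R_2=R_2{}^1\otimes R_2{}^2$ denote two copies of $R$. The convention is $(\Delta\otimes\mathrm{id})R=R_{13}R_{23}$, $(\mathrm{id}\otimes\Delta)R=R_{13}R_{12}$, $R\Delta(h)=\Delta^{op}(h)R$. A finite dimensional quasi-triangular Hopf algebra $(H,R)$ is factorizable if the linear map $H^*\to H$, $p\mapsto\langle p,R_1{}^2R_2{}^1\rangle R_1{}^1R_2{}^2$ is bijective. The left adjoint action is $h\cdot_{ad}h'=h_{(1)}h'S(h_{(2)})$. Transmuted braided group: $H_R$ is the algebra $H$ with the left $H$-action $\cdot_{ad}$ and the coproduct $\Delta_R(h)=h_{(1)}S(R^2)\otimes R^1\cdot_{ad}h_{(2)}$ (counit that of $H$); it is a Hopf algebra in the braided category of finite dimensional left $H$-modules. Subcoalgebras of $H_R$ are subcoalgebras of the coalgebra $(H,\Delta_R)$. *)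

(* Defs.v *)
From HB Require Import structures.
From mathcomp Require Import all_boot all_order all_algebra all_field.

Set Implicit Arguments.
Unset Strict Implicit.
Unset Printing Implicit Defensive.

Import GRing.Theory.
Local Open Scope ring_scope.

Reserved Notation "u *t v" (at level 40, left associativity).

(* An element of U (x) V is the matrix of its coordinates on the products of
   the vectors of the bases vbasis {:U} and vbasis {:V}. *)
Definition tens (K : fieldType) (U V : vectType K) : Type :=
  'M[K]_(\dim {:U}, \dim {:V}).

HB.instance Definition _ (K : fieldType) (U V : vectType K) :=
  Vector.copy (tens U V) 'M[K]_(\dim {:U}, \dim {:V}).

Section Tensor.
Variable K : fieldType.
Implicit Types U V W : vectType K.

Definition ecoord U (i : 'I_(\dim {:U})) (u : U) : K :=
  coord (vbasis {:U}) i u.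

Definition ebase U (i : 'I_(\dim {:U})) : U := (vbasis {:U})`_i.

Definition tpure U V (u : U) (v : V) : tens U V :=
  \matrix_(i, j) (ecoord i u * ecoord j v).

(* The linear map U (x) V -> W induced by f. It is meaningful when f is
   bilinear (see tlift_tpure); then, for t = \sum t^1 (x) t^2, tlift f t is
   \sum f t^1 t^2, which is how Sweedler notation is rendered below. *)
Definition tlift U V (W : lmodType K) (f : U -> V -> W) (t : tens U V) : W :=
  \sum_i \sum_j t i j *: f (ebase i) (ebase j).

Definition tmap U V U' V' (f : U -> U') (g : V -> V') (t : tens U V) :
    tens U' V' :=
  tlift (fun u v => tpure (f u) (g v)) t.

Definition tflip U V (t : tens U V) : tens V U :=
  tlift (fun u v => tpure v u) t.

Definition tassoc U V W (t : tens (tens U V) W) : tens U (tens V W) :=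
  tlift (fun s w => tlift (fun u v => tpure u (tpure v w)) s) t.

Definition tensv U V (A : {vspace U}) (B : {vspace V}) : {vspace tens U V} :=
  <<[seq tpure a b | a <- vbasis A, b <- vbasis B]>>%VS.

Definition bilin U V (W : lmodType K) (f : U -> V -> W) : Prop :=
  (forall v, linear (fun u => f u v)) /\ (forall u, linear (f u)).

Lemma ebase_sum U (u : U) : u = \sum_i ecoord i u *: ebase i.
Proof. exact: coord_vbasis (memvf u). Qed.

Lemma ecoord_ebase U (i j : 'I_(\dim {:U})) : ecoord j (ebase i) = (i == j)%:R.
Proof. by rewrite /ecoord coord_free // (basis_free (vbasisP _)). Qed.

Lemma lin_sumE U (W : lmodType K) (g : U -> W) : linear g ->
  forall u, g u = \sum_i ecoord i u *: g (ebase i).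
Proof.
move=> lg u; pose gL := HB.pack_for {linear U -> W} g
  (GRing.isLinear.Build K U W *:%R g lg).
rewrite -[g]/(gL : U -> W) {1}[u]ebase_sum linear_sum.
by apply: eq_bigr => i _; rewrite linearZ.
Qed.

Lemma tlift_is_linear U V (W : lmodType K) (f : U -> V -> W) :
  linear (tlift f).
Proof.
move=> a s t; rewrite /tlift scaler_sumr -big_split; apply: eq_bigr => i _.
rewrite scaler_sumr -big_split; apply: eq_bigr => j _.
by rewrite !mxE scalerDl scalerA.
Qed.

HB.instance Definition _ U V (W : lmodType K) (f : U -> V -> W) :=
  GRing.isLinear.Build K (tens U V) W *:%R (tlift f) (tlift_is_linear f).

Lemma tlift_tpure U V (W : lmodType K) (f : U -> V -> W) : bilin f ->
  forall u v, tlift f (tpure u v) = f u v.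
Proof.
move=> [fl fr] u v; rewrite (lin_sumE (fl v)); apply: eq_bigr => i _.
rewrite (lin_sumE (fr _) v) scaler_sumr; apply: eq_bigr => j _.
by rewrite mxE scalerA.
Qed.

Lemma tpure_bilin U V : bilin (@tpure U V).
Proof.
split=> [v|u] a x y; apply/matrixP=> i j.
  by rewrite !mxE [ecoord i _]linearD linearZ mulrDl mulrA.
by rewrite !mxE [ecoord j _]linearD linearZ mulrDr mulrCA.
Qed.

Lemma tens_sum U V (t : tens U V) : t = tlift (@tpure U V) t.
Proof.
rewrite {1}[t]matrix_sum_delta; apply: eq_bigr => i _; apply: eq_bigr => j _.
congr (_ *: _); apply/matrixP=> i' j'.
by rewrite !mxE !ecoord_ebase -natrM mulnb (eq_sym i) (eq_sym j).
Qed.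

Lemma lin_tliftE U V (W : lmodType K) (g : tens U V -> W) : linear g ->
  forall t, g t = tlift (fun u v => g (tpure u v)) t.
Proof.
move=> lg t; pose gL := HB.pack_for {linear tens U V -> W} g
  (GRing.isLinear.Build K (tens U V) W *:%R g lg).
rewrite -[g]/(gL : tens U V -> W) {1}[t]tens_sum /tlift linear_sum.
apply: eq_bigr => i _; rewrite linear_sum.
by apply: eq_bigr => j _; rewrite linearZ.
Qed.

Lemma tens_ext U V (W : lmodType K) (g h : tens U V -> W) :
  linear g -> linear h -> (forall u v, g (tpure u v) = h (tpure u v)) -> g =1 h.
Proof.
move=> lg lh gh t; rewrite (lin_tliftE lg) (lin_tliftE lh) /tlift.
by apply: eq_bigr => i _; apply: eq_bigr => j _; rewrite gh.
Qed.

Lemma tlift_linear_fun U V U' (W : lmodType K) (f : U' -> U -> V -> W) t :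
  (forall u v, linear (fun x => f x u v)) -> linear (fun x => tlift (f x) t).
Proof.
move=> lf a x y; rewrite /tlift scaler_sumr -big_split; apply: eq_bigr => i _.
rewrite scaler_sumr -big_split; apply: eq_bigr => j _.
by rewrite lf scalerDr !scalerA (mulrC a).
Qed.

End Tensor.

Notation "u *t v" := (tpure u v) : ring_scope.

Section TensorAlgebra.
Variables (K : fieldType) (A B : falgType K).

Definition tmul (s t : tens A B) : tens A B :=
  tlift (fun a b => tlift (fun c d => (a * c) *t (b * d)) t) s.

Let pl (b : B) : linear (fun a : A => a *t b) := (@tpure_bilin K A B).1 b.
Let pr (a : A) : linear (fun b : B => a *t b) := (@tpure_bilin K A B).2 a.

Fact tmul_linl t : linear (fun s => tmul s t).
Proof. exact: tlift_is_linear. Qed.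

Fact tmul_linr s : linear (tmul s).
Proof.
apply: (@tlift_linear_fun K A B (tens A B) (tens A B)
  (fun t a b => tlift (fun c d => (a * c) *t (b * d)) t)) => u v.
exact: tlift_is_linear.
Qed.

Lemma tmul_tpure a b c d : tmul (a *t b) (c *t d) = (a * c) *t (b * d).
Proof.
have bil x y : bilin (fun (c : A) (d : B) => (x * c) *t (y * d)).
  split=> [v|u] e z w; first by rewrite mulrDr -scalerAr pl.
  by rewrite mulrDr -scalerAr pr.
rewrite /tmul tlift_tpure ?tlift_tpure //; split=> [v|u];
    apply: tlift_linear_fun => x y e z w.
  by rewrite mulrDl -scalerAl pl.
by rewrite mulrDl -scalerAl pr.
Qed.

Fact tmulA : associative tmul.
Proof.
move=> x y z.
have L1 y' z' : linear (fun x => tmul x (tmul y' z')) by exact: tmul_linl.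
have L2 y' z' : linear (fun x => tmul (tmul x y') z').
  by move=> e u v; rewrite !tmul_linl.
apply: (tens_ext (L1 y z) (L2 y z)) => a b {x}.
have L3 z' : linear (fun y => tmul (a *t b) (tmul y z')).
  by move=> e u v; rewrite tmul_linl tmul_linr.
have L4 z' : linear (fun y => tmul (tmul (a *t b) y) z').
  by move=> e u v; rewrite tmul_linr tmul_linl.
apply: (tens_ext (L3 z) (L4 z)) => c d {y}.
have L5 : linear (fun z => tmul (a *t b) (tmul (c *t d) z)).
  by move=> e u v; rewrite !tmul_linr.
apply: (tens_ext L5 (tmul_linr _)) => e f {z}.
by rewrite !tmul_tpure !mulrA.
Qed.

Fact tmul1l : left_id (1 *t 1) tmul.
Proof.
apply: (tens_ext (tmul_linr _)) => [e u v //|a b].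
by rewrite tmul_tpure !mul1r.
Qed.

Fact tmul1r : right_id (1 *t 1) tmul.
Proof.
apply: (tens_ext (tmul_linl _)) => [e u v //|a b].
by rewrite tmul_tpure !mulr1.
Qed.

Fact tmulDl : left_distributive tmul +%R.
Proof. by move=> x y z; have := tmul_linl z 1 x y; rewrite !scale1r. Qed.

Fact tmulDr : right_distributive tmul +%R.
Proof. by move=> x y z; have := tmul_linr x 1 y z; rewrite !scale1r. Qed.

Fact tens1_neq0 : (1 : A) *t (1 : B) != 0.
Proof.
have ex_coord (U : vectType K) (u : U) : u != 0 -> exists i, ecoord i u != 0.
  move=> u0; apply/existsP; apply: contraNT u0; rewrite negb_exists.
  move=> /forallP h; rewrite [u]ebase_sum big1 // => i _.
  by have := h i; rewrite negbK => /eqP->; rewrite scale0r.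
have [i Ai] := ex_coord A 1 (oner_neq0 _).
have [j Bj] := ex_coord B 1 (oner_neq0 _).
apply/eqP => /matrixP /(_ i j) /eqP.
by rewrite !mxE mulf_eq0 (negbTE Ai) (negbTE Bj).
Qed.

HB.instance Definition _ := GRing.Zmodule_isNzRing.Build (tens A B)
  tmulA tmul1l tmul1r tmulDl tmulDr tens1_neq0.

Fact tens_scaleAl (k : K) (x y : tens A B) : k *: (x * y) = (k *: x) * y.
Proof.
apply/esym; transitivity (tmul (k *: x + 0) y); first by rewrite addr0.
by rewrite tmul_linl -[tmul 0 y]/(0 * y) mul0r addr0.
Qed.

HB.instance Definition _ := GRing.Lmodule_isLalgebra.Build K (tens A B)
  tens_scaleAl.

Fact tens_scaleAr (k : K) (x y : tens A B) : k *: (x * y) = x * (k *: y).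
Proof.
apply/esym; transitivity (tmul x (k *: y + 0)); first by rewrite addr0.
by rewrite tmul_linr -[tmul x 0]/(x * 0) mulr0 addr0.
Qed.

HB.instance Definition _ := GRing.Lalgebra_isAlgebra.Build K (tens A B)
  tens_scaleAr.

HB.instance Definition _ := Algebra_isFalgebra.Build K (tens A B).

End TensorAlgebra.

Record hopfAlgebra (K : fieldType) := HopfAlgebra {
  carrier :> falgType K;
  comul : {lrmorphism carrier -> tens carrier carrier};
  counit : {lrmorphism carrier -> K^o};
  antipode : {linear carrier -> carrier};
  comulA : forall h : carrier,
    tassoc (tmap comul (@idfun carrier) (comul h)) =
    tmap (@idfun carrier) comul (comul h);
  counitl : forall h : carrier,
    tlift (fun a b : carrier => counit a *: b) (comul h) = h;
  counitr : forall h : carrier,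
    tlift (fun a b : carrier => counit b *: a) (comul h) = h;
  antipodel : forall h : carrier,
    tlift (fun a b : carrier => antipode a * b) (comul h) = counit h *: 1;
  antipoder : forall h : carrier,
    tlift (fun a b : carrier => a * antipode b) (comul h) = counit h *: 1
}.

Arguments comul {K} H : rename.
Arguments counit {K} H : rename.
Arguments antipode {K} H : rename.

Section QuasiTriangular.
Variables (K : fieldType) (H : hopfAlgebra K).
Implicit Types (R : tens H H) (h x : H) (C I : {vspace H}).

(* The leg embeddings take values in (H (x) H) (x) H. *)
Definition leg12 R : tens (tens H H) H := R *t 1.
Definition leg13 R : tens (tens H H) H := tlift (fun a b : H => (a *t 1) *t b) R.
Definition leg23 R : tens (tens H H) H := tlift (fun a b : H => (1 *t a) *t b) R.

Record quasitriangular R : Prop := Quasitriangular {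
  qt_unit : R \is a GRing.unit;
  qt_comull : tmap (comul H) (@idfun H) R = leg13 R * leg23 R;
  qt_comulr : tmap (@idfun H) (comul H) R = tassoc (leg13 R * leg12 R);
  qt_comm : forall h, R * comul H h = tflip (comul H h) * R
}.

(* p |-> <p, R_1^2 R_2^1> R_1^1 R_2^2 *)
Definition drinfeld_map R (p : 'Hom(H, K^o)) : H :=
  tlift (fun a b : H => tlift (fun c d : H => p (b * c) *: (a * d)) R) R.

Definition factorizable R : Prop :=
  quasitriangular R /\ bijective (drinfeld_map R).

Definition left_ideal I : Prop := forall h x, x \in I -> h * x \in I.

Definition simple_left_ideal I : Prop :=
  [/\ left_ideal I, I != 0%VS
    & forall J : {vspace H}, left_ideal J -> (J <= I)%VS -> J = 0%VS \/ J = I].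

(* The left regular module is a direct sum of simple modules. *)
Definition semisimple : Prop :=
  exists (n : nat) (I : 'I_n -> {vspace H}),
    [/\ forall i, simple_left_ideal (I i),
        directv (\sum_(i < n) I i)
      & (\sum_(i < n) I i)%VS = fullv].

Definition ad h x : H := tlift (fun a b : H => a * x * antipode H b) (comul H h).

(* h |-> h_(1) S(R^2) (x) (R^1 .ad h_(2)) *)
Definition trans_comul R h : tens H H :=
  tlift (fun a b : H =>
    tlift (fun r1 r2 : H => (a * antipode H r2) *t ad r1 b) R) (comul H h).

Definition trans_subcoalgebra R C : Prop :=
  forall c, c \in C -> trans_comul R c \in tensv C C.

Definition ad_stable C : Prop := forall h c, c \in C -> ad h c \in C.

End QuasiTriangular.

Arguments semisimple {K} H.

(* Main.v *)
Require Import Defs.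
From HB Require Import structures.
From mathcomp Require Import all_boot all_order all_algebra all_field.

(** Write Q = R_21 R in H (x) H and, for a linear form p on H, let
    psi(p) = (id (x) p)(Q) be the corresponding slice of Q (monodromy_map). The
    map psi is the transpose of p |-> (id (x) p)(R R_21), which is bijective
    because (H, R) is factorizable; so psi is bijective as well.

    The proof transports the claim along psi, which turns the coalgebra H_R
    with its adjoint action into the algebra H:

    - psi is multiplicative for the convolution p * q = (p (x) q) o Delta_R
      (monodromy_map_conv);
    - psi sends p o (h .ad -) to S(h_(1)) psi(p) h_(2) (monodromy_map_ad),
      because Q commutes with every Delta(h).

    If C is a subcoalgebra of H_R, the forms that vanish on C absorb convolution
    on both sides, so psi maps them onto a two-sided ideal J of H. A two-sided
    ideal is closed under x |-> S(h_(1)) x h_(2); hence if p vanishes on C then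
    psi(p o (h .ad -)) lies in J, and by injectivity of psi the form
    p o (h .ad -) vanishes on C too. As C is the common kernel of the forms
    that vanish on it, C is stable under the adjoint action.

    Multiplicativity carries the computation. The antipode identities
    for R rewrite the braided coproduct as
      Delta_R(h) = theta(Delta(h) R_21),  theta(x (x) y) = x S(s) (x) r y,
    with R = r (x) s (trans_comulE). The hexagon axioms, the Yang-Baxter
    equation and the commutation of Q with coproducts give
      (id (x) Delta)(Q) R_32 = R_21 R_31 R_13 R_12 R_32 = Q_12 R_32 Q_13
    (comulr_monodromy_R), and theta, applied to the legs 2 and 3, erases the
    inner factor R_32 (R_mul_antipode), leaving Q_12 Q_13. *)

Set Implicit Arguments.
Unset Strict Implicit.
Unset Printing Implicit Defensive.

Import GRing.Theory.
Local Open Scope ring_scope.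

(** * Multilinear calculus on tensors *)

Section Multilinear.
Variable K : fieldType.
Implicit Types (U V : vectType K) (W : lmodType K).

Lemma lin_id (V : lmodType K) : linear (fun x : V => x).
Proof. by []. Qed.

Lemma lin_comp (V W X : lmodType K) (g : W -> X) (f : V -> W) :
  linear g -> linear f -> linear (fun x => g (f x)).
Proof. by move=> lg lf a x y; rewrite lf lg. Qed.

Definition mk_linear (V W : lmodType K) (f : V -> W) (lf : linear f) :
  {linear V -> W} := HB.pack f (GRing.isLinear.Build K V W *:%R f lf).

Lemma linZ (V W : lmodType K) (f : V -> W) c x :
  linear f -> f (c *: x) = c *: f x.
Proof.
by move=> lf; rewrite -[f]/(mk_linear lf : V -> W) linearZ.
Qed.

Lemma lin_mull (V : lmodType K) (A : algType K) (f : V -> A) b :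
  linear f -> linear (fun x => f x * b).
Proof. by move=> lf a x y; rewrite lf mulrDl scalerAl. Qed.

Lemma lin_mulr (V : lmodType K) (A : algType K) (f : V -> A) b :
  linear f -> linear (fun x => b * f x).
Proof. by move=> lf a x y; rewrite lf mulrDr scalerAr. Qed.

Lemma lin_scalel (V W : lmodType K) (f : V -> K^o) (w : W) :
  linear f -> linear (fun x => f x *: w).
Proof. by move=> lf a x y; rewrite lf scalerDl scalerA. Qed.

Lemma lin_scaler (V W : lmodType K) (c : K) (f : V -> W) :
  linear f -> linear (fun x => c *: f x).
Proof. by move=> lf a x y; rewrite lf scalerDr !scalerA mulrC. Qed.

Lemma lin_tpurel (X : lmodType K) (U V : vectType K) (f : X -> U) (v : V) :
  linear f -> linear (fun x => f x *t v).
Proof. by move=> lf a x y; rewrite lf (tpure_bilin U V).1. Qed.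

Lemma lin_tpurer (X : lmodType K) (U V : vectType K) (f : X -> V) (u : U) :
  linear f -> linear (fun x => u *t f x).
Proof. by move=> lf a x y; rewrite lf (tpure_bilin U V).2. Qed.

Lemma lin_tlift (X : lmodType K) U V W (f : U -> V -> W) (g : X -> tens U V) :
  linear g -> linear (fun x => tlift f (g x)).
Proof. by move=> lg a x y; rewrite lg linearP. Qed.

Lemma eq_tlift U V W (f g : U -> V -> W) t :
  (forall u v, f u v = g u v) -> tlift f t = tlift g t.
Proof.
by move=> fg; apply: eq_bigr => i _; apply: eq_bigr => j _; rewrite fg.
Qed.

Lemma linear_tlift U V (W X : lmodType K) (g : W -> X) (f : U -> V -> W) t :
  linear g -> g (tlift f t) = tlift (fun u v => g (f u v)) t.
Proof.
move=> lg; rewrite -[g]/(mk_linear lg : W -> X) /tlift linear_sum; apply: eq_bigr => i _.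
by rewrite linear_sum; apply: eq_bigr => j _; rewrite linearZ.
Qed.

Lemma exchange_tlift U V U' V' W (F : U -> V -> U' -> V' -> W) s t :
  tlift (fun u v => tlift (F u v) t) s =
  tlift (fun u' v' => tlift (fun u v => F u v u' v') s) t.
Proof.
rewrite /tlift.
under eq_bigr => i _ do under eq_bigr => j _ do
  (rewrite scaler_sumr; under eq_bigr => k _ do rewrite scaler_sumr).
under [RHS]eq_bigr => i _ do under eq_bigr => j _ do
  (rewrite scaler_sumr; under eq_bigr => k _ do rewrite scaler_sumr).
under eq_bigr => i _ do rewrite exchange_big.
rewrite exchange_big; apply: eq_bigr => k _.
under eq_bigr => i _ do rewrite exchange_big.
rewrite exchange_big; apply: eq_bigr => l _.
apply: eq_bigr => i _; apply: eq_bigr => j _.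
by rewrite !scalerA mulrC.
Qed.

Lemma tpureM (A B : falgType K) (a c : A) (b d : B) :
  (a *t b) * (c *t d) = (a * c) *t (b * d).
Proof. exact: tmul_tpure. Qed.

Lemma mulr_tliftl U V (A : algType K) (f : U -> V -> A) t b :
  tlift f t * b = tlift (fun u v => f u v * b) t.
Proof. exact: (linear_tlift f t (lin_mull b (@lin_id A))). Qed.

Lemma mulr_tliftr U V (A : algType K) (f : U -> V -> A) t b :
  b * tlift f t = tlift (fun u v => b * f u v) t.
Proof. exact: (linear_tlift f t (lin_mulr b (@lin_id A))). Qed.

Lemma scaler_tlift U V W (f : U -> V -> W) t c :
  c *: tlift f t = tlift (fun u v => c *: f u v) t.
Proof. exact: (linear_tlift f t (lin_scaler c (@lin_id W))). Qed.

Lemma scalel_tlift U V W (f : U -> V -> K^o) t (w : W) :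
  (tlift f t : K^o) *: w = tlift (fun u v => f u v *: w) t.
Proof.
exact: (linear_tlift f t (@lin_scalel K^o W (fun x => x) w (@lin_id K^o))).
Qed.

Lemma mulr_tlift U V U' V' (A : algType K) (f : U -> V -> A)
    (g : U' -> V' -> A) s t :
  tlift f s * tlift g t =
  tlift (fun u v => tlift (fun u' v' => f u v * g u' v') t) s.
Proof.
by rewrite mulr_tliftl; apply: eq_tlift => u v; rewrite mulr_tliftr.
Qed.

End Multilinear.

(** Linearity of a map x |-> e(x) is proved by descending from the head of e
    to the only place where x occurs; hypotheses supply the linearity of
    variables, in each of their arguments. *)
Ltac lin :=
  cbv beta;
  first [ exact: linearP
        | exact: lin_id
        | (match goal with L : _ |- _ => solve [exact: L] end)
        | apply: lin_mull; lin
        | apply: lin_mulr; lin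
        | apply: lin_tpurel; lin
        | apply: lin_tpurer; lin
        | apply: lin_scaler; lin
        | apply: lin_scalel; lin
        | apply: lin_tlift; lin
        | (apply: tlift_linear_fun => ? ?); lin
        | (match goal with L : _ |- _ =>
             first [ apply: (lin_comp L) | apply: (lin_comp (L _))
                   | apply: (lin_comp (L _ _)) ] end); lin
        | (match goal with |- linear (fun x => ?g (@?f x)) =>
             apply: (@lin_comp _ _ _ _ g f); [exact: linearP|] end); lin ].
Ltac bilin := split=> ?; lin.

(** * Coproduct and antipode of a Hopf algebra *)

Definition trilin (K : fieldType) (U V W : vectType K) (X : lmodType K)
    (F : U -> V -> W -> X) : Prop :=
  [/\ forall v w, linear (fun u => F u v w), forall u w, linear (fun v => F u v w)
    & forall u v, linear (F u v)].

Ltac trilin := split=> ? ?; lin.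

Section Hopf.
Variables (K : fieldType) (H : hopfAlgebra K).
Local Notation D := (comul H).
Local Notation S := (antipode H).
Local Notation eps := (counit H).

Lemma comul_coassoc (W : lmodType K) (F : H -> H -> H -> W) h : trilin F ->
  tlift (fun u c => tlift (fun a b => F a b c) (D u)) (D h) =
  tlift (fun a v => tlift (F a) (D v)) (D h).
Proof.
case=> F1 F2 F3.
pose L (s : tens H (tens H H)) : W := tlift (fun a => tlift (F a)) s.
have lL : linear L by exact: linearP.
have LE a t : L (a *t t) = tlift (F a) t by rewrite /L tlift_tpure //; bilin.
transitivity (L (tassoc (tmap D (@idfun H) (D h)))); last first.
  rewrite comulA /tmap (linear_tlift _ _ lL); apply: eq_tlift => a v.
  by rewrite LE.
rewrite /tassoc /tmap.
rewrite (@linear_tlift _ _ _ _ _ (fun s => L (tlift _ s))); last by lin.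
apply: eq_tlift => u c /=.
rewrite tlift_tpure; last by bilin.
rewrite (linear_tlift _ _ lL); apply: eq_tlift => a b.
by rewrite LE tlift_tpure //; bilin.
Qed.

Lemma comulM (W : lmodType K) (F : H -> H -> W) x y : bilin F ->
  tlift F (D (x * y)) =
  tlift (fun a b => tlift (fun c d => F (a * c) (b * d)) (D y)) (D x).
Proof.
move=> bF; case: (bF) => F1 F2; rewrite rmorphM.
rewrite -[_ * _]/(tmul _ _) /tmul linear_tlift; last by lin.
apply: eq_tlift => a b; rewrite linear_tlift; last by lin.
by apply: eq_tlift => c d; rewrite tlift_tpure.
Qed.

Lemma counit_comull (W : lmodType K) (f : H -> W) h : linear f ->
  tlift (fun a b => eps a *: f b) (D h) = f h.
Proof.
move=> lf; rewrite -[in RHS](counitl h) linear_tlift //.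
by apply: eq_tlift => a b; rewrite linZ.
Qed.

Lemma counit_comulr (W : lmodType K) (f : H -> W) h : linear f ->
  tlift (fun a b => eps b *: f a) (D h) = f h.
Proof.
move=> lf; rewrite -[in RHS](counitr h) linear_tlift //.
by apply: eq_tlift => a b; rewrite linZ.
Qed.

Lemma antipode1 : S 1 = 1.
Proof.
have := antipodel (1 : H); rewrite !rmorph1 scale1r.
by rewrite -[X in tlift _ X]/(1 *t 1) tlift_tpure ?mulr1 //; bilin.
Qed.

(** Both S(x y) and S(y) S(x) are convolution inverses of the product on
    H (x) H; the proof computes
    S(x_(1) y_(1)) x_(2) y_(2) S(y_(3)) S(x_(3)) in two ways. *)
Lemma antipodeM x y : S (x * y) = S y * S x.
Proof.
have convl u v : tlift (fun a b => tlift (fun c d => S (a * c) * (b * d)) (D v)) (D u)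
   = eps u *: (eps v *: 1).
  rewrite -(comulM (F := fun a b => S a * b)); last by bilin.
  by rewrite antipodel rmorphM scalerA.
have convr u v : tlift (fun a b => tlift (fun c d => a * c * (S d * S b)) (D v)) (D u)
   = eps u *: (eps v *: 1).
  transitivity (tlift (fun a b => eps v *: (a * S b)) (D u)).
    apply: eq_tlift => a b.
    transitivity (a * (eps v *: 1) * S b); last by rewrite -scalerAr mulr1 scalerAl.
    rewrite -antipoder mulr_tliftr mulr_tliftl.
    by apply: eq_tlift => c d; rewrite !mulrA.
  by rewrite -scaler_tlift antipoder scalerA mulrC -scalerA.
transitivity (tlift (fun x1 x2 => tlift (fun y1 y2 => tlift (fun a b =>
    tlift (fun c d => S (x1 * y1) * (a * c * (S d * S b))) (D y2)) (D x2)) (D y)) (D x)).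
  rewrite -(counit_comulr x (f := fun x => S (x * y))); last by lin.
  apply: eq_tlift => x1 x2.
  rewrite -(counit_comulr y (f := fun y => eps x2 *: S (x1 * y))); last by lin.
  apply: eq_tlift => y1 y2.
  transitivity (S (x1 * y1) * (eps x2 *: (eps y2 *: 1))).
    by rewrite -!scalerAr mulr1 !scalerA mulrC.
  rewrite -convr mulr_tliftr.
  by apply: eq_tlift => a b; rewrite mulr_tliftr.
transitivity (tlift (fun u b => tlift (fun v d => tlift (fun x1 a =>
    tlift (fun y1 c => S (x1 * y1) * (a * c * (S d * S b))) (D v)) (D u)) (D y)) (D x)).
  under eq_tlift => x1 x2 do rewrite exchange_tlift.
  rewrite -(comul_coassoc (F := fun x1 a b => tlift (fun y1 y2 =>
    tlift (fun c d => S (x1 * y1) * (a * c * (S d * S b))) (D y2)) (D y))); last first.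
    by trilin.
  apply: eq_tlift => u b; rewrite [RHS]exchange_tlift.
  apply: eq_tlift => x1 a.
  rewrite -(comul_coassoc (F := fun y1 c d =>
    S (x1 * y1) * (a * c * (S d * S b)))) //.
  by trilin.
rewrite -(counit_comull x (f := fun x => S y * S x)); last by lin.
apply: eq_tlift => u b.
rewrite -(counit_comull y (f := fun y => eps u *: (S y * S b))); last by lin.
apply: eq_tlift => v d.
transitivity (eps u *: (eps v *: 1) * (S d * S b)); last first.
  by rewrite -!scalerAl mul1r !scalerA mulrC.
rewrite -convl [RHS]mulr_tliftl; apply: eq_tlift => x1 a.
by rewrite [RHS]mulr_tliftl; apply: eq_tlift => y1 c; rewrite !mulrA.
Qed.

End Hopf.

(** * Tensors spread over commuting legs *)

Section Legs.
Variable K : fieldType.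
Implicit Types (A B C : falgType K) (T : algType K).

Record alg_morphism A T (f : A -> T) : Prop := AlgMorphism {
  amL : linear f; am1 : f 1 = 1; amM : {morph f : x y / x * y} }.

Definition commuting A B T (f : A -> T) (g : B -> T) : Prop :=
  forall x y, f x * g y = g y * f x.

(** For commuting f, g : H -> T, leg f g R is the element usually written
    R_ij, f and g being the embeddings of the i-th and j-th legs. Keeping the
    legs arbitrary makes each identity between the R_ij available for every
    permutation of the indices. *)
Definition leg A B T (f : A -> T) (g : B -> T) (t : tens A B) : T :=
  tlift (fun a b => f a * g b) t.

Lemma commutingC A B T (f : A -> T) (g : B -> T) :
  commuting f g -> commuting g f.
Proof. by move=> fg x y; rewrite fg. Qed.

Lemma leg_linear A B T (f : A -> T) (g : B -> T) : linear (leg f g).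
Proof. exact: linearP. Qed.

Lemma leg_tpure A B T (f : A -> T) (g : B -> T) a b :
  linear f -> linear g -> leg f g (a *t b) = f a * g b.
Proof. by move=> lf lg; rewrite /leg tlift_tpure //; bilin. Qed.

Lemma legM A B T (f : A -> T) (g : B -> T) : alg_morphism f ->
  alg_morphism g -> commuting f g -> {morph leg f g : s t / s * t}.
Proof.
move=> [lf f1 fM] [lg g1 gM] fg s t.
rewrite -[s * t]/(tmul s t) /tmul linear_tlift; last exact: leg_linear.
rewrite [in RHS]/leg mulr_tlift; apply: eq_tlift => a b.
rewrite linear_tlift; last exact: leg_linear.
apply: eq_tlift => c d; rewrite leg_tpure // fM gM.
by rewrite -!mulrA (mulrA (f c)) fg !mulrA.
Qed.

Lemma leg1 A B T (f : A -> T) (g : B -> T) : alg_morphism f ->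
  alg_morphism g -> leg f g 1 = 1.
Proof.
move=> [lf f1 fM] [lg g1 gM].
by rewrite -[1]/(1 *t 1) leg_tpure // f1 g1 mulr1.
Qed.

Lemma leg_tflip A B T (f : A -> T) (g : B -> T) t : linear f -> linear g ->
  commuting f g -> leg g f (tflip t) = leg f g t.
Proof.
move=> lf lg fg; rewrite /tflip linear_tlift; last exact: leg_linear.
by apply: eq_tlift => a b; rewrite leg_tpure.
Qed.

Lemma commuting_leg A B C T (f : A -> T) (g : B -> T) (h : C -> T) :
  commuting h f -> commuting h g -> commuting h (leg f g).
Proof.
move=> hf hg x t; rewrite /leg mulr_tliftr [RHS]mulr_tliftl; apply: eq_tlift => a b.
by rewrite -[RHS]mulrA -hg !mulrA hf.
Qed.

End Legs.

(** * The universal R-matrix and the braided coproduct *)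

Section RMatrix.
Variables (K : fieldType) (H : hopfAlgebra K) (R : tens H H).
Hypothesis qR : quasitriangular R.
Local Notation D := (comul H).
Local Notation S := (antipode H).
Local Notation eps := (counit H).

(** The hexagon axioms, tested on trilinear maps: this is the form in which
    they can be used in Sweedler style. *)
Lemma comull_R (W : lmodType K) (F : H -> H -> H -> W) : trilin F ->
  tlift (fun u v => tlift (fun x y => F x y v) (D u)) R =
  tlift (fun a b => tlift (fun a' b' => F a a' (b * b')) R) R.
Proof.
case=> F1 F2 F3.
pose L (s : tens (tens H H) H) : W := tlift (fun t c => tlift (fun a b => F a b c) t) s.
have lL : linear L by exact: linearP.
have LE t c : L (t *t c) = tlift (fun a b => F a b c) t.
  by rewrite /L tlift_tpure //; bilin.
transitivity (L (tmap D (@idfun H) R)).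
  by rewrite /tmap (linear_tlift _ _ lL); apply: eq_tlift => u v; rewrite LE.
rewrite (qt_comull qR) /leg13 /leg23 mulr_tlift (linear_tlift _ _ lL).
apply: eq_tlift => a b; rewrite (linear_tlift _ _ lL); apply: eq_tlift => a' b'.
by rewrite !tpureM mulr1 mul1r LE tlift_tpure //; bilin.
Qed.

Lemma comulr_R (W : lmodType K) (F : H -> H -> H -> W) : trilin F ->
  tlift (fun u v => tlift (F u) (D v)) R =
  tlift (fun a b => tlift (fun a' b' => F (a * a') b' b) R) R.
Proof.
case=> F1 F2 F3.
pose L (s : tens H (tens H H)) : W := tlift (fun a => tlift (F a)) s.
have lL : linear L by exact: linearP.
have LE a t : L (a *t t) = tlift (F a) t by rewrite /L tlift_tpure //; bilin.
transitivity (L (tmap (@idfun H) D R)).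
  by rewrite /tmap (linear_tlift _ _ lL); apply: eq_tlift => u v; rewrite LE.
rewrite (qt_comulr qR) /leg13 mulr_tliftl.
have lLa : linear (fun s => L (tassoc s)) by rewrite /tassoc; lin.
rewrite (linear_tlift _ _ lLa); apply: eq_tlift => a b.
have -> : leg12 R = tlift (fun a b => (a *t b) *t 1) R.
  rewrite /leg12 {1}(tens_sum R) (@linear_tlift _ _ _ _ _ (fun s => s *t _)) //; lin.
rewrite mulr_tliftr (linear_tlift _ _ lLa); apply: eq_tlift => a' b'.
rewrite !tpureM mulr1 mul1r /tassoc tlift_tpure; last by bilin.
by rewrite tlift_tpure ?LE ?tlift_tpure //; bilin.
Qed.

Lemma alg_morphism_id : alg_morphism (@idfun H).
Proof. by split. Qed.

Lemma alg_morphism_counit : alg_morphism (fun h : H => eps h *: (1 : H)).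
Proof.
split; first by lin.
  by rewrite rmorph1 scale1r.
by move=> x y; rewrite rmorphM -scalerAl mul1r scalerA.
Qed.

Lemma commuting_counit (f : H -> H) : commuting f (fun h : H => eps h *: (1 : H)).
Proof. by move=> x y; rewrite -scalerAr -scalerAl mulr1 mul1r. Qed.

(** R is invertible, so its image under an algebra morphism is an invertible
    element; an invertible idempotent is 1. This gives both counit identities. *)
Lemma leg_R_idempotent (f g : H -> H) : alg_morphism f -> alg_morphism g ->
  commuting f g -> leg f g R = leg f g R * leg f g R -> leg f g R = 1.
Proof.
move=> fA gA fg idem; have := leg1 fA gA; rewrite -(mulrV (qt_unit qR)).
rewrite (legM fA gA fg) => e1.
by rewrite -[LHS]mulr1 -e1 mulrA -idem.
Qed.

Lemma counitr_R : tlift (fun a b => eps b *: a) R = 1.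
Proof.
transitivity (leg (@idfun H) (fun h : H => eps h *: (1 : H)) R).
  by apply: eq_tlift => a b; rewrite -scalerAr mulr1.
apply: leg_R_idempotent (alg_morphism_id) alg_morphism_counit (commuting_counit _) _.
transitivity (tlift (fun u v : H =>
    tlift (fun b c : H => eps c *: (eps b *: u)) (D v)) R).
  apply: eq_tlift => u v; rewrite -scalerAr mulr1.
  by rewrite (counit_comulr v (f := fun v => eps v *: u)) //; lin.
rewrite (comulr_R (F := fun x y z : H => eps z *: (eps y *: x))); last by trilin.
rewrite [RHS]mulr_tlift; apply: eq_tlift => a b; apply: eq_tlift => a' b'.
by rewrite -!scalerAr !mulr1 -scalerAl !scalerA mulrC.
Qed.

Lemma counitl_R : tlift (fun a b => eps a *: b) R = 1.
Proof.
transitivity (leg (fun h : H => eps h *: (1 : H)) (@idfun H) R).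
  by apply: eq_tlift => a b; rewrite -scalerAl mul1r.
apply: leg_R_idempotent alg_morphism_counit alg_morphism_id _ _.
  exact/commutingC/commuting_counit.
transitivity (tlift (fun u v : H =>
    tlift (fun a b : H => eps a *: (eps b *: v)) (D u)) R).
  apply: eq_tlift => u v; rewrite -scalerAl mul1r.
  by rewrite (counit_comull u (f := fun u => eps u *: v)) //; lin.
rewrite (comull_R (F := fun x y z : H => eps x *: (eps y *: z))); last by trilin.
rewrite [RHS]mulr_tlift; apply: eq_tlift => a b; apply: eq_tlift => a' b'.
by rewrite -!scalerAl !mul1r -scalerAr.
Qed.

(** In H (x) H^op the tensor (id (x) S)(R) is a left inverse of R. The sum on
    the left is F evaluated on (id (x) mul (id (x) S) Delta)(R), by the second
    hexagon axiom, and this is (id (x) eps)(R) (x) 1. *)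
Lemma R_mul_antipode (W : lmodType K) (F : H -> H -> W) : bilin F ->
  tlift (fun a b => tlift (fun a' b' => F (a * a') (b' * S b)) R) R = F 1 1.
Proof.
move=> [F1 F2].
rewrite -(comulr_R (F := fun x y z => F x (y * S z))); last by trilin.
rewrite -[X in _ = F X _]counitr_R (linear_tlift _ _ (F1 _)); apply: eq_tlift => u v.
by rewrite -(linear_tlift _ _ (F2 _)) antipoder (linZ _ _ (F2 _)) (linZ _ _ (F1 _)).
Qed.

(** (S (x) id)(R) is a left inverse of R in H (x) H. *)
Lemma antipode_R_mul (W : lmodType K) (F : H -> H -> W) : bilin F ->
  tlift (fun a b => tlift (fun a' b' => F (S a * a') (b * b')) R) R = F 1 1.
Proof.
move=> [F1 F2].
rewrite -(comull_R (F := fun x y z => F (S x * y) z)); last by trilin.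
rewrite -[X in _ = F _ X]counitl_R (linear_tlift _ _ (F2 _)); apply: eq_tlift => u v.
by rewrite -(linear_tlift _ _ (F1 _)) antipodel (linZ _ _ (F1 _)) (linZ _ _ (F2 _)).
Qed.

(** In H (x) H^op both R and (S (x) S)(R) are inverse to (id (x) S)(R), so they
    agree. *)
Lemma antipode_R (W : lmodType K) (F : H -> H -> W) : bilin F ->
  tlift (fun a b => F (S a) (S b)) R = tlift F R.
Proof.
move=> bF; case: (bF) => F1 F2.
(* Both sides are values of the sum of F on
     S(a) a' a'' (x) b'' S(b') S(b),
     as a' a'' (x) b'' S(b') and S(a) a' (x) b b' both sum to 1 (x) 1. *)
transitivity (tlift (fun a b => tlift (fun a' b' => tlift (fun a'' b'' =>
   F (S a * (a' * a'')) (b'' * S b' * S b)) R) R) R).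
  apply: eq_tlift => a b.
  rewrite (R_mul_antipode (F := fun x y => F (S a * x) (y * S b))).
    by rewrite mulr1 mul1r.
  by bilin.
transitivity (tlift (fun a'' b'' => tlift (fun a b => tlift (fun a' b' =>
   F (S a * a' * a'') (b'' * S (b * b'))) R) R) R).
  under eq_tlift => a b do rewrite exchange_tlift.
  rewrite exchange_tlift; apply: eq_tlift => a'' b''.
  apply: eq_tlift => a b; apply: eq_tlift => a' b'.
  by rewrite antipodeM !mulrA.
apply: eq_tlift => a'' b''.
rewrite (antipode_R_mul (F := fun x y => F (x * a'') (b'' * S y))); last by bilin.
by rewrite antipode1 mul1r mulr1.
Qed.

(** The first hexagon axiom splits the action of R^1 into r y S(r') with
    S(R^2) = S(s') S(s), and (S (x) S)(R) = R then removes the antipodes from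
    the copy r' (x) s'. What remains is Delta(h) R_21 with a copy of R
    wrapped around it. *)
Lemma trans_comulE h : trans_comul R h =
  tlift (fun x y => tlift (fun a b => tlift (fun a' b' =>
    (x * b' * S b) *t (a * y * a')) R) R) (D h).
Proof.
apply: eq_tlift => x y.
transitivity (tlift (fun r1 r2 => tlift (fun u v =>
    (x * S r2) *t (u * y * S v)) (D r1)) R).
  by apply: eq_tlift => r1 r2; rewrite /ad linear_tlift //; lin.
rewrite (comull_R (F := fun u v r2 => (x * S r2) *t (u * y * S v))); last by trilin.
apply: eq_tlift => a b.
rewrite -(antipode_R (F := fun a' b' => (x * b' * S b) *t (a * y * a'))); last by bilin.
by apply: eq_tlift => a' b'; rewrite antipodeM mulrA.
Qed.

End RMatrix.

(** * Yang-Baxter equation and the monodromy R_21 R *)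

Definition monodromy (K : fieldType) (H : hopfAlgebra K) (R : tens H H) : tens H H :=
  tflip R * R.

Section Legs3.
Variables (K : fieldType) (H : hopfAlgebra K) (R : tens H H).
Hypothesis qR : quasitriangular R.
Variables (T : algType K).
Implicit Types f g h : H -> T.
Local Notation D := (comul H).

Lemma comull_leg f g h : alg_morphism f -> alg_morphism g -> alg_morphism h ->
  commuting g h ->
  tlift (fun u v => leg f g (D u) * h v) R = leg f h R * leg g h R.
Proof.
case=> lf _ _ [lg _ _] [lh _ hM] gh.
transitivity (tlift (fun u v => tlift (fun x y => f x * g y * h v) (D u)) R).
  by apply: eq_tlift => u v; rewrite /leg mulr_tliftl.
rewrite (comull_R qR (F := fun x y v => f x * g y * h v)); last by trilin.
rewrite [RHS]mulr_tlift; apply: eq_tlift => a b; apply: eq_tlift => a' b'.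
by rewrite hM !mulrA -(mulrA (f a)) gh !mulrA.
Qed.

Lemma comulr_leg f g h : alg_morphism f -> alg_morphism g -> alg_morphism h ->
  commuting f h -> commuting g h ->
  tlift (fun u v => f u * leg g h (D v)) R = leg f h R * leg f g R.
Proof.
case=> lf _ fM [lg _ _] [lh _ _] fh gh.
transitivity (tlift (fun u v => tlift (fun x y => f u * (g x * h y)) (D v)) R).
  by apply: eq_tlift => u v; rewrite /leg mulr_tliftr.
rewrite (comulr_R qR (F := fun u x y => f u * (g x * h y))); last by trilin.
rewrite [RHS]mulr_tlift; apply: eq_tlift => a b; apply: eq_tlift => a' b'.
by rewrite fM gh -!mulrA; congr (_ * _); rewrite !mulrA fh.
Qed.

Lemma leg_R_comul f g u : alg_morphism f -> alg_morphism g -> commuting f g ->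
  leg f g R * leg f g (D u) = leg g f (D u) * leg f g R.
Proof.
move=> fA gA fg; rewrite -(legM fA gA fg) (qt_comm qR) (legM fA gA fg).
by rewrite (leg_tflip _ (amL gA) (amL fA)) //; apply: commutingC.
Qed.

(** R_12 R_13 R_23 = R_12 (Delta (x) id)(R), and R_12 exchanges Delta with
    the opposite coproduct. *)
Lemma yang_baxter f g h : alg_morphism f -> alg_morphism g -> alg_morphism h ->
  commuting f g -> commuting f h -> commuting g h ->
  leg f g R * leg f h R * leg g h R = leg g h R * leg f h R * leg f g R.
Proof.
move=> fA gA hA fg fh gh; rewrite -mulrA -comull_leg // -comull_leg //.
rewrite mulr_tliftr mulr_tliftl; apply: eq_tlift => u v.
rewrite mulrA leg_R_comul // -!mulrA; congr (_ * _).
by rewrite (commuting_leg (commutingC fh) (commutingC gh)).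
Qed.

Lemma leg_monodromy f g : alg_morphism f -> alg_morphism g -> commuting f g ->
  leg f g (monodromy R) = leg g f R * leg f g R.
Proof.
move=> fA gA fg; rewrite /monodromy (legM fA gA fg).
by rewrite (leg_tflip _ (amL gA) (amL fA)) //; apply: commutingC.
Qed.

(** R turns Delta into the opposite coproduct and R_21 turns it back. *)
Lemma leg_monodromy_comul f g u : alg_morphism f -> alg_morphism g -> commuting f g ->
  leg f g (monodromy R) * leg f g (D u) = leg f g (D u) * leg f g (monodromy R).
Proof.
move=> fA gA fg; rewrite leg_monodromy // -mulrA leg_R_comul // !mulrA leg_R_comul //.
Qed.

(** (id (x) Delta)(R_21 R) = R_21 R_31 R_13 R_12: as id (x) Delta is an algebra
    morphism, the hexagon axioms apply to each factor. *)
Lemma comulr_monodromy f g h : alg_morphism f -> alg_morphism g -> alg_morphism h ->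
  commuting f g -> commuting f h -> commuting g h ->
  tlift (fun u v => f u * leg g h (D v)) (monodromy R) =
  leg g f R * leg h f R * (leg f h R * leg f g R).
Proof.
move=> fA gA hA fg fh gh; set j := fun v => leg g h (D v).
have jA : alg_morphism j.
  split; first by rewrite /j /leg; lin.
    by rewrite /j rmorph1 leg1.
  by move=> x y; rewrite /j rmorphM (legM gA hA gh).
have fj : commuting f j by move=> x y; apply: commuting_leg.
rewrite -[LHS]/(leg f j (monodromy R)) leg_monodromy //; congr (_ * _).
  exact: comull_leg (commutingC fh).
exact: comulr_leg.
Qed.

(** (id (x) Delta)(Q) R_32 = Q_12 R_32 Q_13 for Q = R_21 R. Two uses of the
    Yang-Baxter equation bring R_32 to the front and put Q_12 together:
    R_21 R_31 R_13 R_12 R_32 = R_32 R_31 Q_12 R_13. Here R_32 R_31 is a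
    coproduct in the legs 1 and 2, so Q_12 moves past it, and
    R_31 R_13 = Q_13 is left on the right. *)
Lemma comulr_monodromy_R f g h : alg_morphism f -> alg_morphism g -> alg_morphism h ->
  commuting f g -> commuting f h -> commuting g h ->
  tlift (fun u v => f u * leg g h (D v)) (monodromy R) * leg h g R =
  leg f g (monodromy R) * leg h g R * leg f h (monodromy R).
Proof.
move=> fA gA hA fg fh gh.
have [gf hf hg] := And3 (commutingC fg) (commutingC fh) (commutingC gh).
rewrite comulr_monodromy //.
transitivity (leg h g R * leg h f R * leg f g (monodromy R) * leg f h R).
  rewrite leg_monodromy // -!mulrA [leg f h R * _]mulrA yang_baxter // !mulrA.
  by rewrite -yang_baxter.
rewrite -comulr_leg // [leg f h (monodromy R)]leg_monodromy // !mulrA; congr (_ * _).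
rewrite -[RHS]mulrA -comulr_leg // mulr_tliftl mulr_tliftr; apply: eq_tlift => u v.
rewrite -mulrA -leg_monodromy_comul // !mulrA; congr (_ * _).
exact: (commuting_leg hf hg).
Qed.

(** The sum over the middle factor is innermost: it is the one that cancels
    against a wrapped copy of R, for fixed values of the other two. *)
Lemma mulr_leg3 f1 g1 f2 g2 f3 g3 (s r t : tens H H) :
  leg f1 g1 s * leg f2 g2 r * leg f3 g3 t =
  tlift (fun u v => tlift (fun u' v' => tlift (fun a b =>
    f1 u * g1 v * (f2 a * g2 b) * (f3 u' * g3 v')) r) t) s.
Proof.
rewrite /leg [X in X * _]mulr_tlift [LHS]mulr_tliftl; apply: eq_tlift => u v.
by rewrite [LHS]mulr_tlift exchange_tlift.
Qed.

End Legs3.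

(** * Slicing the monodromy *)

Section MonodromyMap.
Variables (K : fieldType) (H : hopfAlgebra K) (R : tens H H).
Hypothesis qR : quasitriangular R.
Local Notation D := (comul H).
Local Notation S := (antipode H).
Local Notation eps := (counit H).
Implicit Types p q : H -> K^o.

Definition monodromy_map p : H := tlift (fun u v : H => p v *: u) (monodromy R).

(** The product of the dual algebra of the coalgebra H_R. *)
Definition braided_conv p q (h : H) : K^o :=
  tlift (fun u v : H => p u *: q v) (trans_comul R h).

(** The slice psi(p * q) is G applied to the legs 2 and 3 of
    (id (x) Delta)(Q) R_32 = Q_12 R_32 Q_13, where G is p (x) q composed with
    the map theta that wraps a copy of R around its argument. In the product on
    the right that copy cancels R_32. *)
Lemma monodromy_map_conv p q : linear p -> linear q ->
  monodromy_map (braided_conv p q) = monodromy_map p * monodromy_map q.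
Proof.
move=> lp lq.
pose T : algType K := tens H (tens H H).
pose f (x : H) : T := x *t 1.
pose g (x : H) : T := 1 *t (x *t 1).
pose h (x : H) : T := 1 *t (1 *t x).
have fA : alg_morphism f.
  by split; [rewrite /f; lin | | move=> x y; rewrite /f tpureM mulr1].
have gA : alg_morphism g.
  by split; [rewrite /g; lin | | move=> x y; rewrite /g !tpureM !mulr1].
have hA : alg_morphism h.
  by split; [rewrite /h; lin | | move=> x y; rewrite /h !tpureM !mulr1].
have fg : commuting f g by move=> x y; rewrite /f /g !tpureM !mulr1 !mul1r.
have fh : commuting f h by move=> x y; rewrite /f /h !tpureM !mulr1 !mul1r.
have gh : commuting g h by move=> x y; rewrite /g /h !tpureM !mulr1 !mul1r.
have leg_gh t : leg g h t = 1 *t t.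
  rewrite [in RHS](tens_sum t) linear_tlift; last by lin.
  by apply: eq_tlift => x y; rewrite /g /h !tpureM !mulr1 !mul1r.
pose G (t : tens H H) : K^o :=
  tlift (fun y z => tlift (fun a b => p (y * S b) *: q (a * z)) R) t.
pose E (t : T) : H := tlift (fun x s => G s *: x) t.
have lG : linear G by exact: linearP.
have lE : linear E by exact: linearP.
have GE y z : G (y *t z) = tlift (fun a b => p (y * S b) *: q (a * z)) R.
  by rewrite /G tlift_tpure //; bilin.
have EE x s : E (x *t s) = G s *: x by rewrite /E tlift_tpure //; bilin.
have conv_G v : braided_conv p q v = G (D v * tflip R).
  rewrite /braided_conv (trans_comulE qR) linear_tlift; last by lin.
  transitivity (G (tlift (fun x y => tlift (fun a b => (x * b) *t (y * a)) R) (D v))).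
    rewrite (linear_tlift _ _ lG); apply: eq_tlift => x y.
    rewrite (linear_tlift _ _ lG) exchange_tlift linear_tlift; last by lin.
    apply: eq_tlift => a b; rewrite GE linear_tlift; last by lin.
    by apply: eq_tlift => a' b'; rewrite tlift_tpure ?mulrA //; bilin.
  congr (G _); rewrite {2}(tens_sum (D v)) /tflip mulr_tlift.
  by apply: eq_tlift => x y; apply: eq_tlift => a b; rewrite tpureM.
have leg_hg : leg h g R = leg g h (tflip R).
  by rewrite (leg_tflip _ (amL hA) (amL gA)) //; apply: commutingC.
transitivity (E (tlift (fun u v => f u * leg g h (D v)) (monodromy R) * leg h g R)).
  rewrite mulr_tliftl (linear_tlift _ _ lE); apply: eq_tlift => u v.
  by rewrite leg_hg !leg_gh /f !tpureM !mulr1 !mul1r EE conv_G.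
rewrite comulr_monodromy_R // mulr_leg3 (linear_tlift _ _ lE).
rewrite /monodromy_map [RHS]mulr_tlift; apply: eq_tlift => u v.
rewrite (linear_tlift _ _ lE); apply: eq_tlift => u' v'.
rewrite (linear_tlift _ _ lE).
transitivity (tlift (fun a b => tlift (fun a' b' =>
   (p (v * (b' * S b)) *: q (a * a' * v')) *: (u * u')) R) R).
  rewrite exchange_tlift; apply: eq_tlift => a b.
  rewrite /f /g /h !tpureM !mulr1 !mul1r EE GE.
  rewrite scalel_tlift.
  by apply: eq_tlift => a' b'; rewrite !mulrA.
rewrite (R_mul_antipode qR (F := fun x y => (p (v * y) *: q (x * v')) *: (u * u'))).
  by rewrite mulr1 mul1r -scalerAl -scalerAr scalerA.
by bilin.
Qed.

Lemma monodromy_map_linear a p q :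
  monodromy_map (fun x => a *: p x + q x) =
  a *: monodromy_map p + monodromy_map q.
Proof.
rewrite /monodromy_map /tlift scaler_sumr -big_split; apply: eq_bigr => i _.
rewrite scaler_sumr -big_split; apply: eq_bigr => j _.
rewrite scalerDl scalerDr -[(a *: _) *: _]scalerA; congr (_ + _).
by rewrite !scalerA mulrCA mulrA.
Qed.

(** Write E(h) for the left side. The commutation of Q with coproducts gives
    psi(p) w = w_(1) E(w_(2)) (the claim absorb), and multiplication by
    S(h_(1)) on the left, with w = h_(2), isolates E(h). *)
Lemma monodromy_map_ad p h : linear p ->
  monodromy_map (fun x => p (ad h x)) =
  tlift (fun a b => S a * monodromy_map p * b) (D h).
Proof.
move=> lp.
have ad_lin x : linear (fun h => ad h x) by rewrite /ad; lin.
have monodromy_comul u : monodromy R * D u = D u * monodromy R.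
  have := @leg_monodromy_comul K H R qR (tens H H) (fun x => x *t 1) (fun x => 1 *t x) u.
  have leg_id t : leg (fun x : H => x *t (1 : H)) (fun x => 1 *t x) t = t.
    rewrite [RHS]tens_sum; apply: eq_tlift => x y.
    by rewrite tpureM mulr1 mul1r.
  rewrite !leg_id; apply.
  - by split; [lin | | move=> x y; rewrite tpureM mulr1].
  - by split; [lin | | move=> x y; rewrite tpureM mulr1].
  - by move=> x y; rewrite !tpureM !mulr1 !mul1r.
pose E h' := monodromy_map (fun x => p (ad h' x)).
have lE : linear E by rewrite /E /monodromy_map; lin.
have absorb w : monodromy_map p * w = tlift (fun a b => a * E b) (D w).
  pose M t b : H := tlift (fun x y => p (y * S b) *: x) t.
  have lM b : linear (fun t => M t b) by exact: linearP.
  have lM2 t : linear (M t) by rewrite /M; lin.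
  have ME x y b : M (x *t y) b = p (y * S b) *: x.
    by rewrite /M tlift_tpure //; bilin.
  transitivity (tlift (fun a b => M (D a * monodromy R) b) (D w)); last first.
    transitivity (tlift (fun a v : H => tlift (fun x y : H => tlift (fun u u' : H =>
        p (x * u' * S y) *: (a * u)) (monodromy R)) (D v)) (D w)).
      rewrite -(comul_coassoc (F := fun a x y : H => tlift (fun u u' : H =>
         p (x * u' * S y) *: (a * u)) (monodromy R))); last by trilin.
      apply: eq_tlift => a b; rewrite {1}(tens_sum (D a)) mulr_tliftl.
      rewrite (linear_tlift _ _ (lM b)); apply: eq_tlift => x y.
      rewrite {1}(tens_sum (monodromy R)) mulr_tliftr (linear_tlift _ _ (lM b)).
      by apply: eq_tlift => u u'; rewrite tpureM ME.
    apply: eq_tlift => a v; rewrite /E /monodromy_map mulr_tliftr exchange_tlift.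
    apply: eq_tlift => u u'; rewrite /ad (linear_tlift _ _ lp).
    rewrite scalel_tlift mulr_tliftr.
    by apply: eq_tlift => x y; rewrite scalerAr.
  transitivity (tlift (fun a v : H => tlift (fun x y : H => tlift (fun u u' : H =>
        p (u' * (x * S y)) *: (u * a)) (monodromy R)) (D v)) (D w)).
    transitivity (tlift (fun a v : H => tlift (fun u u' : H =>
        p (u' * (eps v *: 1)) *: (u * a)) (monodromy R)) (D w)).
      rewrite -(counit_comulr w (f := fun w => monodromy_map p * w)); last by lin.
      apply: eq_tlift => a v; rewrite /monodromy_map [in LHS]mulr_tliftl.
      rewrite (scaler_tlift (fun u u' : H => p u' *: u * a) (monodromy R) (eps v)).
      apply: eq_tlift => u u'.
      by rewrite -scalerAr mulr1 (linZ _ _ lp) -scalerAl scalerA.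
    apply: eq_tlift => a v; rewrite exchange_tlift; apply: eq_tlift => u u'.
    rewrite -antipoder mulr_tliftr (linear_tlift _ _ lp).
    exact: scalel_tlift.
  rewrite -(comul_coassoc (F := fun a x y : H => tlift (fun u u' : H =>
     p (u' * (x * S y)) *: (u * a)) (monodromy R))); last by trilin.
  apply: eq_tlift => a b; rewrite -monodromy_comul {2}(tens_sum (D a)) mulr_tliftr.
  rewrite (linear_tlift _ _ (lM b)); apply: eq_tlift => x y.
  rewrite {2}(tens_sum (monodromy R)) mulr_tliftl (linear_tlift _ _ (lM b)).
  by apply: eq_tlift => u u'; rewrite tpureM ME mulrA.
transitivity (tlift (fun a b => tlift (fun x y => S a * (x * E y)) (D b)) (D h)).
  rewrite -(comul_coassoc (F := fun a x y => S a * (x * E y))); last by trilin.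
  rewrite -[LHS]/(E h) -(counit_comull h lE); apply: eq_tlift => a b.
  transitivity ((eps a *: 1) * E b); first by rewrite -scalerAl mul1r.
  rewrite -antipodel [LHS]mulr_tliftl.
  by apply: eq_tlift => x y; rewrite mulrA.
by apply: eq_tlift => a b; rewrite -mulrA absorb [RHS]mulr_tliftr.
Qed.

End MonodromyMap.

(** * Subcoalgebras and two-sided ideals *)

Lemma separating_functional (K : fieldType) (V : vectType K) (U : {vspace V}) x :
  x \notin U ->
  exists2 q : 'Hom(V, K^o), forall u, u \in U -> q u = 0 & q x != 0.
Proof.
move=> xU; pose y v := v - projv U v.
have ly : linear y.
  by move=> a u v; rewrite /y linearP scalerBr opprD addrACA.
have y0 : y x != 0.
  by rewrite subr_eq0; apply: contraNneq xU => ->; apply: memv_proj.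
have [i yi] : exists i, ecoord i (y x) != 0.
  apply/existsP; apply: contraNT y0; rewrite negb_exists => /forallP h.
  rewrite [y x]ebase_sum big1 // => i _.
  by have := h i; rewrite negbK => /eqP->; rewrite scale0r.
have lq : linear (fun v => ecoord i (y v) : K^o).
  by move=> a u v; rewrite ly /ecoord linearP.
exists (linfun (mk_linear lq)) => [u uU|]; rewrite lfunE //=.
by rewrite /y projv_id // subrr /ecoord linear0.
Qed.

Section Subcoalgebras.
Variables (K : fieldType) (H : hopfAlgebra K) (R : tens H H).
Hypothesis facR : factorizable R.
Let qR : quasitriangular R := facR.1.

(** R R_21 is the flip of R_21 R, so the two slicing maps are transposes of
    each other. *)
Lemma drinfeld_map_adjoint (p q : 'Hom(H, K^o)) :
  p (drinfeld_map R q) = q (monodromy_map R p).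
Proof.
have -> : monodromy_map R p =
  tlift (fun a b : H => tlift (fun c d : H => p (a * d) *: (b * c)) R) R.
  rewrite /monodromy_map /monodromy {2}(tens_sum R) /tflip mulr_tlift.
  rewrite linear_tlift; last by lin.
  apply: eq_tlift => a b; rewrite linear_tlift; last by lin.
  by apply: eq_tlift => c d; rewrite tpureM tlift_tpure //; bilin.
have [lp lq] := (@linearP _ _ _ _ p, @linearP _ _ _ _ q).
rewrite /drinfeld_map !linear_tlift //; apply: eq_tlift => a b.
rewrite !linear_tlift //; apply: eq_tlift => c d.
by rewrite !linearZ; apply: mulrC.
Qed.

Lemma monodromy_map_inj p : linear p -> monodromy_map R p = 0 -> p =1 (fun=> 0).
Proof.
move=> lp p0 x; case: facR => _ [inv _ invK].
pose pL := linfun (mk_linear lp).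
have pE y : pL y = p y by rewrite lfunE.
rewrite -pE -(invK x) drinfeld_map_adjoint -[RHS](linear0 (inv x)); congr (_ _).
by rewrite -p0; apply: eq_tlift => u v; rewrite pE.
Qed.

(** A form q that vanishes on the image of psi satisfies p (phi q) = 0 for all
    p, where phi is the Drinfeld map; so phi q = 0 and q = 0. *)
Lemma monodromy_map_surj x : exists2 p, linear p & monodromy_map R p = x.
Proof.
have lpsi : linear (fun p : 'Hom(H, K^o) => monodromy_map R p).
  move=> a p q; rewrite -monodromy_map_linear; apply: eq_tlift => u v.
  by rewrite add_lfunE scale_lfunE.
pose psiL := linfun (mk_linear lpsi).
have psiE p : psiL p = monodromy_map R p by rewrite lfunE.
have [/memv_imgP[p _ ->]|] := boolP (x \in limg psiL).
  by exists p; [exact: linearP | rewrite psiE].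
case/separating_functional => q q0 /negP[].
have dq0 : drinfeld_map R q = 0.
  apply/eqP/idPn; rewrite -memv0 => /separating_functional[p _ /negP[]].
  by rewrite drinfeld_map_adjoint -psiE q0 // memv_img ?memvf.
have -> : q = 0.
  case: facR => _ /bij_inj; apply; rewrite dq0 /drinfeld_map.
  rewrite /tlift big1 // => i _; rewrite big1 // => j _.
  rewrite big1 ?scaler0 // => k _; rewrite big1 // => l _.
  by rewrite zero_lfunE scale0r scaler0.
by rewrite zero_lfunE.
Qed.

Lemma tensv_killed (U V : vectType K) (A : {vspace U}) (B : {vspace V})
    (W : vectType K) (L : tens U V -> W) t : linear L ->
  (forall a b, a \in A -> b \in B -> L (a *t b) = 0) ->
  t \in tensv A B -> L t = 0.
Proof.
move=> lL L0; have /subvP sub : (tensv A B <= lker (linfun (mk_linear lL)))%VS.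
  apply/span_subvP => _ /allpairsP[[a b] [/= aA bB ->]].
  by rewrite memv_ker (lfunE (mk_linear lL)) /= L0 // vbasis_mem.
by move=> /sub; rewrite memv_ker (lfunE (mk_linear lL)) => /eqP.
Qed.

Lemma subcoalgebra_stable (C : {vspace H}) :
  trans_subcoalgebra R C -> ad_stable C.
Proof.
move=> subC.
pose vanish (p : H -> K^o) := forall c, c \in C -> p c = 0.
(* J is the image under psi of the annihilator of C, a two-sided ideal. *)
pose J x := exists p, [/\ linear p, vanish p & monodromy_map R p = x].
have conv_linear p q : linear p -> linear q -> linear (braided_conv R p q).
  move=> lp lq; rewrite /braided_conv /trans_comul /ad; lin.
have conv_vanish p q : linear p -> linear q -> vanish p \/ vanish q ->
    vanish (braided_conv R p q).
  move=> lp lq pq c cC; apply: tensv_killed (subC c cC); first exact: linearP.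
  move=> a b aC bC; rewrite tlift_tpure; last by bilin.
  by case: pq => [p0|q0]; rewrite ?p0 ?q0 ?scale0r ?scaler0.
have Jl x y : J x -> J (y * x).
  case=> p [lp p0 <-]; have [q lq <-] := monodromy_map_surj y.
  by exists (braided_conv R q p); split; [auto | auto | rewrite monodromy_map_conv].
have Jr x y : J x -> J (x * y).
  case=> p [lp p0 <-]; have [q lq <-] := monodromy_map_surj y.
  by exists (braided_conv R p q); split; [auto | auto | rewrite monodromy_map_conv].
have JL a x y : J x -> J y -> J (a *: x + y).
  move=> [p [lp p0 <-]] [q [lq q0 <-]].
  exists (fun x => a *: p x + q x); split; last exact: monodromy_map_linear.
    by move=> b u v; rewrite lp lq !scalerDr !scalerA addrACA (mulrC a).
  by move=> c cC; rewrite p0 // q0 // scaler0 addr0.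
have J0 : J 0.
  have [p lp p0] := monodromy_map_surj 0; exists (fun=> 0); split => //.
    by move=> a x y; rewrite scaler0 addr0.
  rewrite /monodromy_map /tlift big1 // => i _; rewrite big1 // => j _.
  by rewrite scale0r scaler0.
have JT (F : H -> H -> H) t : (forall a b, J (F a b)) -> J (tlift F t).
  move=> JF; apply: (big_ind J) => // [x y Jx Jy|i _].
    by rewrite -[x]scale1r; apply: JL.
  apply: (big_ind J) => // [x y Jx Jy|j _].
    by rewrite -[x]scale1r; apply: JL.
  by rewrite -[_ *: _]addr0; apply: JL.
(* q vanishes on C but not at ad h c; p vanishes on C and has the same image
   under psi as q o ad h, so it equals q o ad h. *)
move=> h c cC; apply/idPn => /separating_functional[q q0 /negP[]].
have lq : linear q by exact: linearP.
have Jq : J (monodromy_map R q) by exists q.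
have : J (monodromy_map R (fun x => q (ad h x))).
  by rewrite (monodromy_map_ad qR) //; apply: JT => a b; apply/Jr/Jl.
case=> p [lp p0 pq].
have ladq : linear (fun x => q (ad h x)) by rewrite /ad; lin.
have /monodromy_map_inj : linear (fun x => (-1) *: p x + q (ad h x)).
  by move=> a x y; rewrite lp ladq !scalerDr !scalerA addrACA mulrC.
move=> /(_ _)/(_ c); rewrite p0 // scaler0 add0r => -> //.
by rewrite monodromy_map_linear pq scaleN1r addNr.
Qed.

End Subcoalgebras.

Theorem lemma8 (k : closedFieldType) (H : hopfAlgebra k) (R : tens H H)
  (ssH : semisimple H) (facR : factorizable R) (C : {vspace H})
  (subC : trans_subcoalgebra R C) : ad_stable C.
Proof. exact: subcoalgebra_stable facR C subC. Qed.
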